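(* Let $\varphi:\mathbb{R}^n\to\mathbb{R}\cup\{+\infty\}$ be a proper, lower semicontinuous, coercive function that is uniformly quasiconvex with modulus $\phi$ on a nonempty closed convex set $C\subseteq\operatorname{dom}\varphi$. Let $p>1$, let $\{x^k\}_{k\ge 0}$ be a sequence generated by HiPPA with order $p$ and parameters $\gamma_k\in(\gamma_{\min},\gamma_{\max})$, and let $\{\overline{x}\}=\arg\min_{x\in C}\varphi(x)$. Then the following hold (quotients being read with the convention $0/0=0$). (a) If there are $q\in(1,2)$ and $\rho_q>0$ with $\rho_q t^q\le\phi(t)$ for all $t\in[0,1)$, if $p\in[q,2)$, and if $\gamma_{\min}>\frac{1}{\rho_q}$, then the convergence rate is locally linear, i.e., there exists $\overline{k}_p\in\mathbb{N}\cup\{0\}$ such that $$\frac{\|\overline{x}-x^{k+1}\|}{\|\overline{x}-x^k\|}\le\left(\frac{1}{\rho_q\gamma_{\min}}\right)^{\frac{1}{p-1}}<1\qquad\text{for all }k\ge\overline{k}_p.$$ (b) If $p=2$ and there is $\rho>0$ with $\rho t^2\le\phi(t)$ for all $t\in[0,+\infty)$, then the convergence rate is linear, i.e., $$\frac{\|\overline{x}-x^{k+1}\|}{\|\overline{x}-x^k\|}\le\frac{1}{1+\gamma_{\min}\rho}<1\qquad\text{for all }k\ge 0.$$ (c) If $p>2$, there is $\rho_p>0$ with $\rho_p t^p\le\phi(t)$ for all $t\in[0,+\infty)$, and $\gamma_{\min}>\frac{1}{\rho_p}$, then the convergence rate is linear, i.e., $$\frac{\|\overline{x}-x^{k+1}\|}{\|\overline{x}-x^k\|}\le\left(\frac{p}{p\gamma_{\min}\rho_p+\widehat{\sigma}_p}\right)^{\frac{1}{p-1}}<1\qquad\text{for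 all }k\ge 0,$$ where $\widehat{\sigma}_p=\left(\frac12\right)^{\frac{3p-2}{2}}$. (d) If there are $q\ge 2$ and $\rho_q>0$ with $\rho_q t^q\le\phi(t)$ for all $t\in[0,+\infty)$, and if $p>q$, then the convergence is $Q$-superlinear of order $\frac{p-1}{q-1}$; in particular, with $c=(\gamma_{\min}\rho_q)^{-\frac{1}{q-1}}$, $$\|x^{k+1}-\overline{x}\|\le c\,\|x^k-\overline{x}\|^{\frac{p-1}{q-1}}\qquad\text{for all }k\ge 0.$$
   Context: $\|\cdot\|$ is the Euclidean norm on $\mathbb{R}^n$; $\operatorname{dom}\varphi=\{x:\varphi(x)<+\infty\}$; $\varphi$ is proper if $\operatorname{dom}\varphi\ne\emptyset$, and coercive if $\varphi(x)\to+\infty$ as $\|x\|\to+\infty$. A modulus is an increasing function $\phi:[0,+\infty)\to[0,+\infty]$ (i.e. $s\le t$ implies $\phi(s)\le\phi(t)$) that vanishes only at $0$. The function $\varphi$ is uniformly quasiconvex with modulus $\phi$ on a convex set $C\subseteq\operatorname{dom}\varphi$ if for all $x,y\in C$ and $\lambda\in[0,1]$, $$\varphi(\lambda x+(1-\lambda)y)+\lambda(1-\lambda)\phi(\|x-y\|)\le\max\{\varphi(x),\varphi(y)\}.$$ HiPPA (high-order proximal-point algorithm) of order $p>1$: fix $\gamma_{\max}>\gamma_{\min}>0$ and $x^0\in C$; for each $k\ge 0$ choose $\gamma_k\in(\gamma_{\min},\gamma_{\max})$ and choose $$x^{k+1}\in\arg\min_{y\in C}\left(\varphi(y)+\frac{1}{p\gamma_k}\|x^k-y\|^p\right).$$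 (Under the hypotheses of the claim these sets of minimizers are nonempty, and $\varphi$ has a unique minimizer $\overline{x}$ on $C$.) A sequence converging to $\overline{x}$ is here said to converge $Q$-superlinearly of order $\alpha>1$ if there is a constant $c>0$ with $\|x^{k+1}-\overline{x}\|\le c\|x^k-\overline{x}\|^{\alpha}$ for all $k$. *)

(* Defs.v *)
From mathcomp Require Import all_boot all_order all_algebra.
From mathcomp Require Import all_classical all_reals all_analysis.
Import Order.TTheory GRing.Theory Num.Theory numFieldNormedType.Exports.

Set Implicit Arguments.
Unset Strict Implicit.
Unset Printing Implicit Defensive.

Local Open Scope classical_set_scope.
Local Open Scope ring_scope.

(* The library norm on ['rV[R]_n] is the sup norm; it induces the same topology
   as [enorm], so the library's [closed], [lower_semicontinuous] and [-->] are
   used unchanged. *)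
Definition enorm (R : realType) (n : nat) (x : 'rV[R]_n) : R :=
  Num.sqrt (\sum_(i < n) x 0 i ^+ 2).

Definition dom (R : realType) (n : nat) (f : 'rV[R]_n -> \bar R) :
    set 'rV[R]_n :=
  [set x | (f x < +oo)%E].

(* The first conjunct says that [f] takes its values in R U {+oo}. *)
Definition proper_fun (R : realType) (n : nat) (f : 'rV[R]_n -> \bar R) : Prop :=
  (forall x, f x != -oo%E) /\ dom f !=set0.

Definition coercive (R : realType) (n : nat) (f : 'rV[R]_n -> \bar R) : Prop :=
  forall A : R, exists r : R, forall x, r < enorm x -> (A%:E < f x)%E.

(* A function [0, +oo) -> [0, +oo] is encoded by a function on all of [R] whose
   values at negative arguments are irrelevant. *)
Definition modulus (R : realType) (phi : R -> \bar R) : Prop :=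
  [/\ forall t, 0 <= t -> (0 <= phi t)%E,
      forall s t, 0 <= s -> s <= t -> (phi s <= phi t)%E
    & forall t, 0 <= t -> (phi t = 0%E <-> t = 0)].

(* For [lambda] equal to 0 or 1 and [phi (enorm (x - y)) = +oo], the product is 0. *)
Definition uniformly_quasiconvex (R : realType) (n : nat)
    (f : 'rV[R]_n -> \bar R) (phi : R -> \bar R) (C : set 'rV[R]_n) : Prop :=
  forall x y lambda, C x -> C y -> 0 <= lambda <= 1 ->
    (f (lambda *: x + (1 - lambda) *: y)%R
       + (lambda * (1 - lambda))%:E * phi (enorm (x - y)%R)
     <= Order.max (f x) (f y))%E.

Definition argmin (R : realType) (n : nat) (C : set 'rV[R]_n)
    (f : 'rV[R]_n -> \bar R) : set 'rV[R]_n :=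
  [set x | C x /\ forall y, C y -> (f x <= f y)%E].

Definition prox_objective (R : realType) (n : nat) (f : 'rV[R]_n -> \bar R)
    (p g : R) (z : 'rV[R]_n) : 'rV[R]_n -> \bar R :=
  fun y => (f y + (1 / (p * g) * enorm (z - y)%R `^ p)%:E)%E.

Definition HiPPA (R : realType) (n : nat) (C : set 'rV[R]_n)
    (f : 'rV[R]_n -> \bar R) (p gmin gmax : R) (gamma : nat -> R)
    (x : nat -> 'rV[R]_n) : Prop :=
  [/\ 0 < gmin < gmax, C (x 0%N), forall k, gmin < gamma k < gmax
    & forall k, argmin C (prox_objective f p (gamma k) (x k)) (x k.+1)].

Definition Qsuperlinear (R : realType) (n : nat) (x : nat -> 'rV[R]_n)
    (xbar : 'rV[R]_n) (alpha : R) : Prop :=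
  [/\ x @ \oo --> xbar, 1 < alpha
    & exists2 c : R, 0 < c & forall k,
        enorm (x k.+1 - xbar) <= c * enorm (x k - xbar) `^ alpha].

(* In [\bar R] the library has 0^-1 = +oo and 0 * +oo = 0; hence 0 / 0 = 0,
   whereas a / 0 = +oo for a > 0. *)
Definition err_ratio (R : realType) (n : nat) (x : nat -> 'rV[R]_n)
    (xbar : 'rV[R]_n) (k : nat) : \bar R :=
  ((enorm (xbar - x k.+1)%R)%:E / (enorm (xbar - x k)%R)%:E)%E.

Definition sigma_hat (R : realType) (p : R) : R :=
  (1 / 2) `^ ((3 * p - 2) / 2).

(* Main.v *)
(* Write z = x^k, u = x^{k+1}, b = xbar, a = z - u, d = u - b.  Comparing the
   proximal objective at u and at l b + (1 - l) u, whose distance vector to z is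
   a + l d, quasiconvexity gives
   l (1 - l) phi |d| <= (|a + l d|^p - |a|^p) / (p gamma).  Young's inequality
   bounds t^p - s^p by p t^(p-1) (t - s), so letting l -> 0 yields <a, d> >= 0,
   gamma phi |d| <= |a|^(p-1) |d| and
   gamma phi |d| |a| <= |a|^(p-1) <a, d>.
   The first makes |a| and |d| at most |z - b| and the steps square summable,
   hence x^k -> xbar; the second gives (a) and (d).  For p >= 2 the third,
   together with <a, d> <= |z - b| |d| - |d|^2, gives
   (gamma rho + 1) |d|^(p-1) <= |z - b|^(p-1), which implies (b) and, since
   sigma_hat p < 1 < p, also (c). *)

Require Import Defs.
From mathcomp Require Import all_boot all_order all_algebra.
From mathcomp Require Import all_classical all_reals all_analysis.
From mathcomp Require Import ring lra.
Import Order.TTheory GRing.Theory Num.Theory numFieldNormedType.Exports.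

Set Implicit Arguments.
Unset Strict Implicit.

Local Open Scope classical_set_scope.
Local Open Scope ring_scope.

(** * Euclidean inner product and norm *)

Definition dotv (R : realType) (n : nat) (x y : 'rV[R]_n) : R :=
  \sum_(i < n) x 0 i * y 0 i.

Lemma dotvDl (R : realType) (n : nat) (x y z : 'rV[R]_n) :
  dotv (x + y) z = dotv x z + dotv y z.
Proof. by rewrite -big_split; apply: eq_bigr => i _; rewrite mxE mulrDl. Qed.

Lemma dotvZl (R : realType) (n : nat) (c : R) (x y : 'rV[R]_n) :
  dotv (c *: x) y = c * dotv x y.
Proof. by rewrite mulr_sumr; apply: eq_bigr => i _; rewrite mxE mulrA. Qed.

Lemma dotvC (R : realType) (n : nat) (x y : 'rV[R]_n) : dotv x y = dotv y x.
Proof. by apply: eq_bigr => i _; rewrite mulrC. Qed.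

Lemma enorm_ge0 (R : realType) (n : nat) (x : 'rV[R]_n) : 0 <= enorm x.
Proof. exact: sqrtr_ge0. Qed.

Lemma enorm_sqr (R : realType) (n : nat) (x : 'rV[R]_n) :
  enorm x ^+ 2 = dotv x x.
Proof.
by rewrite sqr_sqrtr ?sumr_ge0 // => i _; rewrite sqr_ge0.
Qed.

Lemma enormBC (R : realType) (n : nat) (x y : 'rV[R]_n) :
  enorm (x - y) = enorm (y - x).
Proof.
by congr Num.sqrt; apply: eq_bigr => i _; rewrite !mxE -sqrrN opprB.
Qed.

Lemma entry_le_enorm (R : realType) (n : nat) (x : 'rV[R]_n) (i : 'I_n) :
  `|x 0 i| <= enorm x.
Proof.
rewrite -sqrtr_sqr ler_sqrt; last by rewrite sumr_ge0 // => k _; rewrite sqr_ge0.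
by rewrite (bigD1 i) //= lerDl sumr_ge0 // => k _; rewrite sqr_ge0.
Qed.

(** Transfers smallness of [enorm] to the library topology, whose norm is the sup norm. *)
Lemma normr_le_enorm (R : realType) (n : nat) (x : 'rV[R]_n) : `|x| <= enorm x.
Proof.
rewrite /Num.norm /= mx_normrE; apply/bigmax_leP; split=> [|[i j] _ /=].
  exact: enorm_ge0.
by rewrite ord1; exact: entry_le_enorm.
Qed.

Lemma enorm_sqrD (R : realType) (n : nat) (l : R) (x y : 'rV[R]_n) :
  enorm (x + l *: y) ^+ 2 =
  enorm x ^+ 2 + l * dotv x y *+ 2 + l ^+ 2 * enorm y ^+ 2.
Proof.
rewrite !enorm_sqr !dotvDl ![dotv _ (x + _)]dotvC !dotvDl !dotvZl.
by rewrite ![dotv _ (l *: y)]dotvC !dotvZl (dotvC y x); ring.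
Qed.

Lemma dotv_le_enorm (R : realType) (n : nat) (x y : 'rV[R]_n) :
  dotv x y <= enorm x * enorm y.
Proof.
have [y0|y_gt0] := leP (enorm y) 0.
  rewrite [dotv x y]big1 ?mulr_ge0 ?enorm_ge0 // => i _.
  have := le_trans (entry_le_enorm y i) y0.
  by rewrite normr_le0 => /eqP ->; rewrite mulr0.
apply: le_trans (ler_norm _) _.
rewrite -ler_sqr ?nnegrE ?mulr_ge0 ?enorm_ge0 // real_normK ?num_real //.
(* The vector is the residual of projecting [x] onto the line of [y]; its squared norm times |y|^2
   is |x|^2 |y|^2 - <x, y>^2. *)
have := sqr_ge0 (enorm (x + (- (dotv x y / enorm y ^+ 2)) *: y)).
rewrite enorm_sqrD -(pmulr_rge0 _ (exprn_gt0 2 y_gt0)) -subr_ge0 => H.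
apply: le_trans H _; rewrite le_eqVlt; apply/orP; left; apply/eqP.
by field; rewrite gt_eqF.
Qed.

Lemma enormD_le (R : realType) (n : nat) (l : R) (x y : 'rV[R]_n) :
  0 <= l -> enorm (x + l *: y) <= enorm x + l * enorm y.
Proof.
move=> l0; rewrite -ler_sqr ?nnegrE ?addr_ge0 ?mulr_ge0 ?enorm_ge0 //.
rewrite enorm_sqrD.
have := ler_wpM2l l0 (dotv_le_enorm x y); lra.
Qed.

(** * Real powers and one-sided limits at 0 *)

Lemma ler_powR_base (R : realType) (r x y : R) :
  0 <= r -> 0 <= x -> x <= y -> x `^ r <= y `^ r.
Proof.
by move=> r0 x0 xy; rewrite ge0_ler_powR ?nnegrE // (le_trans x0).
Qed.

Lemma cvg_onemMr (R : realType) (c : R) : (1 - l) * c @[l --> 0^'+] --> c.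
Proof.
have : (1 - l) * c @[l --> (0 : R)^'+] --> (1 - 0) * c.
  apply: cvgM; last exact: cvg_cst.
  by apply: cvgB; [exact: cvg_cst|exact: cvg_within].
by rewrite subr0 mul1r.
Qed.

Lemma cvg_addMr (R : realType) (b c : R) : b + l * c @[l --> 0^'+] --> b.
Proof.
have : b + l * c @[l --> (0 : R)^'+] --> b + 0 * c.
  apply: cvgD; first exact: cvg_cst.
  by apply: cvgM; [exact: cvg_within|exact: cvg_cst].
by rewrite mul0r addr0.
Qed.

Lemma cvg_powRDl (R : realType) (r s D : R) : 0 < r -> 0 <= s -> 0 <= D ->
  (s + l * D) `^ r @[l --> 0^'+] --> s `^ r.
Proof.
move=> r0 s0 D0; apply/cvgrPdist_le => e e0.
have D1 : 0 < D + 1 by lra.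
(* [y] is the point whose [r]-th power is s^r + e, so it suffices to keep s + l D below [y]. This
   treats s = 0 and s > 0 alike; dividing by D + 1 below covers D = 0. *)
set y := (s `^ r + e) `^ r^-1.
have sy : s < y.
  rewrite -[X in X < _](powRr1 s0) -[X in s `^ X < _](divff (lt0r_neq0 r0)).
  by rewrite powRrM gt0_ltr_powR ?nnegrE ?addr_ge0 ?powR_ge0 ?invr_gt0 ?ltrDl ?ltW.
have yr : y `^ r = s `^ r + e.
  by rewrite -powRrM mulVf ?gt_eqF // powRr1 // addr_ge0 ?powR_ge0 ?ltW.
near=> l.
have l0 : 0 <= l by apply: ltW; near: l; exact: nbhs_right_gt.
have lD : l * D <= y - s.
  have : l < (y - s) / (D + 1).
    by near: l; apply: nbhs_right_lt; rewrite divr_gt0 ?subr_gt0.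
  by rewrite ltr_pdivlMr // mulrDr mulr1 => h; lra.
have lD0 := mulr_ge0 l0 D0.
rewrite distrC ger0_norm ?subr_ge0; last first.
  by rewrite ge0_ler_powR ?nnegrE ?addr_ge0 ?lerDl // ltW.
rewrite lerBlDl -yr ge0_ler_powR ?nnegrE ?addr_ge0 ?powR_ge0 //; first exact: ltW.
by rewrite -lerBrDl.
Unshelve. all: by end_near. Qed.

(** The tangent inequality of the convex power at [t], obtained from Young's inequality for s *
    t^(p-1) with exponents p and p / (p - 1). *)
Lemma powR_tangent_le (R : realType) (p s t : R) : 1 < p -> 0 <= s -> 0 <= t ->
  t `^ p - s `^ p <= p * (t `^ (p - 1) * (t - s)).
Proof.
move=> p1 s0 t0; have p0 : 0 < p by lra.
have pB1 : 0 < p - 1 by lra.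
have q0 : 0 < p / (p - 1) by rewrite divr_gt0.
have := conjugate_powR s0 (powR_ge0 t (p - 1)) p0 q0.
rewrite -powRrM mulrCA divff ?gt_eqF // mulr1.
have -> : p^-1 + (p / (p - 1))^-1 = 1 by field; rewrite !gt_eqF.
move=> /(_ erefl); rewrite -(ler_pM2l p0).
have -> : p * (s `^ p / p + t `^ p / (p / (p - 1))) = s `^ p + (p - 1) * t `^ p.
  by field; rewrite !gt_eqF.
have := mulr_powRB1 t0 p0; nra.
Qed.

(** * The proximal inequality on the segment from [u] to the minimizer [b] *)

Lemma prox_point_gap (R : realType) (n : nat) (f : 'rV[R]_n -> \bar R)
  (phi : R -> \bar R) (C : set 'rV[R]_n) (p g l m : R) (z u b : 'rV[R]_n) :
  proper_fun f -> convex_set C -> C `<=` dom f ->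
  uniformly_quasiconvex f phi C -> argmin C f b ->
  argmin C (prox_objective f p g z) u ->
  0 <= l <= 1 -> (m%:E <= phi (enorm (u - b)))%E ->
  l * (1 - l) * m <= 1 / (p * g) *
    (enorm (z - u + l *: (u - b)) `^ p - enorm (z - u) `^ p).
Proof.
move=> [fNy _] Cconv Cdom fuqc [Cb bmin] [Cu umin] l01 mphi.
have [l0 l1] := andP l01.
(* Adds quasiconvexity and proximal optimality so that the values of [f] at [y] and [u] cancel; [A]
   and [B] are the penalties at [y] and [u], and [c] is the modulus term. *)
have aux (fy fu A B c : R) : fy + c <= fu -> fu + B <= fy + A -> c <= A - B.
  by lra.
pose y := l *: b + (1 - l) *: u.
have Cy : C y.
  have := Cconv b u (Itv01 l0 l1); rewrite !inE => /(_ Cb Cu).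
  by [].
have fin v : C v -> f v \is a fin_num.
  by move=> Cv; rewrite fin_numE fNy /= lt_eqF //; exact: Cdom.
have zy : z - y = z - u + l *: (u - b).
  by apply/rowP => i; rewrite !mxE; ring.
have := fuqc b u l Cb Cu l01; rewrite enormBC.
rewrite (max_idPr (bmin u Cu)) -/y => H1.
have := umin y Cy; rewrite /prox_objective zy.
have ll0 : 0 <= l * (1 - l) by rewrite mulr_ge0 // subr_ge0.
(* The modulus may be +oo at this distance; the real minorant [m] replaces it, so that everything
   left is finite. *)
have : ((l * (1 - l) * m)%:E <= (l * (1 - l))%:E * phi (enorm (u - b)))%E.
  by rewrite EFinM lee_wpmul2l // lee_fin.
move=> /(leeD2l (f y)) /le_trans /(_ H1).
rewrite -(fineK (fin _ Cy)) -(fineK (fin _ Cu)) -!EFinD !lee_fin [1 / _ * (_ - _)]mulrBr.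
exact: aux.
Qed.

(** * First-order consequences of the proximal inequality *)

Section ProxDirection.
Variables (R : realType) (n : nat) (p g m : R) (a d : 'rV[R]_n).
Hypotheses (p_gt1 : 1 < p) (g_gt0 : 0 < g) (m_ge0 : 0 <= m).
Hypothesis gap : forall l, 0 <= l <= 1 -> l * (1 - l) * m <=
  1 / (p * g) * (enorm (a + l *: d) `^ p - enorm a `^ p).

Lemma gap_scaled l : 0 <= l <= 1 -> p * (l * ((1 - l) * (g * m))) <=
  enorm (a + l *: d) `^ p - enorm a `^ p.
Proof.
have p0 := lt_trans ltr01 p_gt1.
move=> /gap; rewrite mul1r [X in _ <= X]mulrC ler_pdivlMr ?mulr_gt0 //.
apply: le_trans; rewrite le_eqVlt; apply/orP; left; apply/eqP; ring.
Qed.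

Lemma enorm_le_gap l : 0 <= l <= 1 -> enorm a <= enorm (a + l *: d).
Proof.
move=> l01; have p0 := lt_trans ltr01 p_gt1.
rewrite leNgt; apply/negP => /(gt0_ltr_powR p0).
rewrite !nnegrE !enorm_ge0 => /(_ isT isT); apply/negP; rewrite -leNgt -subr_ge0.
apply: le_trans (gap_scaled l01).
case/andP: l01 => l0 l1.
by rewrite !mulr_ge0 ?subr_ge0 // ltW.
Qed.

Lemma gap_dotv_ge0 : 0 <= dotv a d.
Proof.
rewrite leNgt; apply/negP => w0.
set w := dotv a d in w0 *; set D := enorm d ^+ 2.
have D0 : 0 <= D by rewrite sqr_ge0.
have E0 : 0 < D + 1 - w by lra.
(* This [l] lies in (0, 1] and satisfies l D < - w, hence 2 w + l D < 0: the norm would decrease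
   along [d], against [enorm_le_gap]. *)
pose l := - w / (D + 1 - w).
have l0 : 0 < l by rewrite divr_gt0 // oppr_gt0.
have l1 : l <= 1 by rewrite ler_pdivrMr //; lra.
have : enorm a ^+ 2 <= enorm (a + l *: d) ^+ 2.
  by rewrite ler_sqr ?nnegrE ?enorm_ge0 // enorm_le_gap // ltW.
rewrite enorm_sqrD -/w -/D -addrA lerDl.
have H : l * (D + 1 - w) = - w by rewrite divfK // gt_eqF.
have -> : l * w *+ 2 + l ^+ 2 * D = l * (w *+ 2 + l * D) by ring.
nra.
Qed.

(* Divide [gap_scaled] by [l] and let [l] tend to [0]; likewise for
   [gap_le_dotv]. *)
Lemma gap_le_enorm : g * m <= enorm a `^ (p - 1) * enorm d.
Proof.
have pB1 : 0 < p - 1 by rewrite subr_gt0.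
have d0 := enorm_ge0 d; have a0 := enorm_ge0 a.
apply: (@ler_cvg_to _ (0 : R)^'+ _ _ (fun l : R => (1 - l) * (g * m))
  (fun l => (enorm a + l * enorm d) `^ (p - 1) * enorm d)).
- exact: cvg_onemMr.
- by apply: cvgM; [exact: cvg_powRDl|exact: cvg_cst].
near=> l.
have l0 : 0 < l by near: l; exact: nbhs_right_gt.
have l1 : l <= 1 by near: l; exact: nbhs_right_le.
have l01 : 0 <= l <= 1 by rewrite ltW.
have t0 := enorm_ge0 (a + l *: d).
have tri := enormD_le a d (ltW l0).
have H := le_trans (gap_scaled l01) (powR_tangent_le p_gt1 a0 t0).
have p0 := lt_trans ltr01 p_gt1.
rewrite ler_pM2l // in H.
rewrite -(ler_pM2l l0); apply: le_trans H _.
rewrite [leRHS]mulrCA.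
apply: ler_pM; rewrite ?powR_ge0 ?subr_ge0 ?enorm_le_gap ?lerBlDl //.
exact: ler_powR_base (ltW pB1) t0 tri.
Unshelve. all: by end_near. Qed.

Lemma gap_le_dotv : g * m * enorm a <= enorm a `^ (p - 1) * dotv a d.
Proof.
have pB1 : 0 < p - 1 by rewrite subr_gt0.
have d0 := enorm_ge0 d; have a0 := enorm_ge0 a; have w0 := gap_dotv_ge0.
(* The factor 2 appears because |a + l d| + |a| tends to 2 |a|. *)
suff : g * m * (enorm a *+ 2) <= enorm a `^ (p - 1) * (dotv a d *+ 2) by lra.
apply: (@ler_cvg_to _ (0 : R)^'+ _ _
  (fun l : R => (1 - l) * (g * m * (enorm a *+ 2)))
  (fun l => (enorm a + l * enorm d) `^ (p - 1) *
    (dotv a d *+ 2 + l * enorm d ^+ 2))).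
- exact: cvg_onemMr.
- apply: cvgM; first exact: cvg_powRDl.
  exact: cvg_addMr.
near=> l.
have l0 : 0 < l by near: l; exact: nbhs_right_gt.
have l1 : l <= 1 by near: l; exact: nbhs_right_le.
have l01 : 0 <= l <= 1 by rewrite ltW.
have t0 := enorm_ge0 (a + l *: d).
have tri := enormD_le a d (ltW l0).
have H := le_trans (gap_scaled l01) (powR_tangent_le p_gt1 a0 t0).
have p0 := lt_trans ltr01 p_gt1.
rewrite ler_pM2l // in H.
have st := enorm_le_gap l01.
have c0 : 0 <= (1 - l) * (g * m) by rewrite !mulr_ge0 ?subr_ge0 // ltW.
have t2 := enorm_sqrD l a d.
(* Multiplying the increment of the norm by the sum of the two norms gives a difference of squares,
   whose first-order term in [l] is 2 <a, d>. *)
have K : (enorm (a + l *: d) - enorm a) * (enorm (a + l *: d) + enorm a) =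
  l * (dotv a d *+ 2 + l * enorm d ^+ 2) by rewrite -subr_sqr t2; ring.
rewrite -(ler_pM2l l0).
apply: (@le_trans _ _ (l * ((1 - l) * (g * m)) *
    (enorm (a + l *: d) + enorm a))).
  have -> : l * ((1 - l) * (g * m * (enorm a *+ 2))) =
    l * ((1 - l) * (g * m)) * (enorm a *+ 2) by ring.
  by apply: ler_wpM2l; [rewrite mulr_ge0 // ltW | rewrite mulr2n lerD2r].
apply: le_trans (ler_wpM2r (addr_ge0 t0 a0) H) _.
rewrite -mulrA K mulrCA ler_pM2l //; apply: ler_wpM2r.
  by rewrite addr_ge0 ?mulrn_wge0 // mulr_ge0 ?sqr_ge0 // ltW.
exact: ler_powR_base (ltW pB1) t0 tri.
Unshelve. all: by end_near. Qed.

End ProxDirection.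

(** * Extraction of roots and error quotients *)

Lemma ler_powR_root (R : realType) (A D Y r : R) : 0 < A -> 0 < r -> 0 <= D ->
  A * D `^ r <= Y -> D <= (Y / A) `^ (1 / r).
Proof.
move=> A0 r0 D0; rewrite mulrC -ler_pdivlMr // => H.
rewrite div1r -[leLHS](powRr1 D0) -(divff (lt0r_neq0 r0)) powRrM.
by apply: ler_powR_base H; rewrite ?invr_ge0 ?powR_ge0 ?ltW.
Qed.

Lemma ler_powR_scale (R : realType) (A D E r : R) : 0 < A -> 0 < r -> 0 <= D ->
  0 <= E -> A * D `^ r <= E `^ r -> D <= (1 / A) `^ (1 / r) * E.
Proof.
move=> A0 r0 D0 E0 /(ler_powR_root A0 r0 D0) H; apply: le_trans H _.
rewrite div1r mulrC powRM ?powR_ge0 ?invr_ge0 ?(ltW A0) // -powRrM div1r.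
by rewrite divff ?gt_eqF // powRr1.
Qed.

Lemma powR_lt1 (R : realType) (a r : R) : 0 <= a < 1 -> 0 < r -> a `^ r < 1.
Proof.
move=> /andP[a0 a1] r0; have <- : 1 `^ r = 1 :> R by rewrite powR1.
by apply: gt0_ltr_powR; rewrite ?nnegrE.
Qed.

Lemma sigma_hat_gt0 (R : realType) (p : R) : 0 < sigma_hat p.
Proof. by rewrite powR_gt0 // divr_gt0. Qed.

Lemma sigma_hat_lt1 (R : realType) (p : R) : 1 < p -> sigma_hat p < 1.
Proof. by move=> p1; apply: powR_lt1; lra. Qed.

Lemma err_ratio_le (R : realType) (n : nat) (x : nat -> 'rV[R]_n)
  (xbar : 'rV[R]_n) (k : nat) (c : R) : 0 <= c ->
  enorm (x k.+1 - xbar) <= c * enorm (x k - xbar) ->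
  (err_ratio x xbar k <= c%:E)%E.
Proof.
rewrite /err_ratio ![enorm (xbar - _)]enormBC => c0.
have [->|e0] := eqVneq (enorm (x k - xbar)) 0.
  (* A zero error stays zero under the assumed bound, so the quotient is 0 / 0 = 0 and not +oo. *)
  rewrite mulr0 => D0.
  have -> : enorm (x k.+1 - xbar) = 0 by apply/le_anti; rewrite D0 enorm_ge0.
  by rewrite mul0e lee_fin.
move=> H; rewrite inver (negPf e0) -EFinM lee_fin ler_pdivrMr //.
by rewrite lt_neqAle eq_sym e0 enorm_ge0.
Qed.

(** * Monotonicity, convergence and power estimates for the iterates *)

Section HiPPAIterates.
Variables (R : realType) (n : nat).
Variables (f : 'rV[R]_n -> \bar R) (phi : R -> \bar R) (C : set 'rV[R]_n).
Variables (p gmin gmax : R) (gamma : nat -> R) (x : nat -> 'rV[R]_n).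
Variable xbar : 'rV[R]_n.
Hypotheses (f_proper : proper_fun f) (C_convex : convex_set C).
Hypotheses (C_dom : C `<=` dom f) (phi_modulus : modulus phi).
Hypotheses (f_uqc : uniformly_quasiconvex f phi C) (p_gt1 : 1 < p).
Hypotheses (x_HiPPA : HiPPA C f p gmin gmax gamma x).
Hypothesis xbar_argmin : argmin C f xbar.

Let e k := enorm (x k - xbar).
Let s k := enorm (x k - x k.+1).
Let w k := dotv (x k - x k.+1) (x k.+1 - xbar).

Lemma HiPPA_gap k m : (m%:E <= phi (e k.+1))%E ->
  forall l, 0 <= l <= 1 -> l * (1 - l) * m <= 1 / (p * gamma k) *
    (enorm (x k - x k.+1 + l *: (x k.+1 - xbar)) `^ p - s k `^ p).
Proof.
case: x_HiPPA => _ _ _ xmin mphi l l01.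
exact: (prox_point_gap f_proper C_convex C_dom f_uqc xbar_argmin (xmin k)).
Qed.

Lemma HiPPA_gmin_gt0 : 0 < gmin.
Proof. by case: x_HiPPA => /andP[]. Qed.

Lemma HiPPA_gamma_gt k : gmin < gamma k.
Proof. by case: x_HiPPA => _ _ /(_ k)/andP[]. Qed.

Lemma HiPPA_gamma_gt0 k : 0 < gamma k.
Proof. exact: lt_trans HiPPA_gmin_gt0 (HiPPA_gamma_gt k). Qed.

Lemma HiPPA_dotv_ge0 k : 0 <= w k.
Proof.
apply: (@gap_dotv_ge0 _ _ p (gamma k) 0) => //; first exact: HiPPA_gamma_gt0.
by apply: HiPPA_gap; case: phi_modulus => phi0 _ _; apply: phi0; exact: enorm_ge0.
Qed.

Lemma HiPPA_modulus_le k m : 0 <= m -> (m%:E <= phi (e k.+1))%E ->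
  gamma k * m <= s k `^ (p - 1) * e k.+1.
Proof.
by move=> m0 /HiPPA_gap; apply: gap_le_enorm => //; exact: HiPPA_gamma_gt0.
Qed.

Lemma HiPPA_modulus_le_dotv k m : 0 <= m -> (m%:E <= phi (e k.+1))%E ->
  gamma k * m * s k <= s k `^ (p - 1) * w k.
Proof.
by move=> m0 /HiPPA_gap; apply: gap_le_dotv => //; exact: HiPPA_gamma_gt0.
Qed.

(** Expands |a + d|^2. As <a, d> >= 0, it yields the monotonicity of the errors and, by telescoping,
    the square summability of the steps. *)
Lemma HiPPA_pythagoras k : e k ^+ 2 = s k ^+ 2 + w k *+ 2 + e k.+1 ^+ 2.
Proof.
have -> : e k = enorm (x k - x k.+1 + 1 *: (x k.+1 - xbar)).
  by rewrite scale1r addrA subrK.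
by rewrite enorm_sqrD expr1n !mul1r.
Qed.

Lemma HiPPA_step_le k : s k <= e k.
Proof.
rewrite -ler_sqr ?nnegrE ?enorm_ge0 // HiPPA_pythagoras -addrA lerDl.
by rewrite addr_ge0 ?sqr_ge0 // mulrn_wge0 // HiPPA_dotv_ge0.
Qed.

Lemma HiPPA_err_le k : e k.+1 <= e k.
Proof.
rewrite -ler_sqr ?nnegrE ?enorm_ge0 // [leRHS]HiPPA_pythagoras lerDr.
by rewrite addr_ge0 ?sqr_ge0 // mulrn_wge0 // HiPPA_dotv_ge0.
Qed.

Lemma HiPPA_err_le_add k j : e (k + j) <= e k.
Proof.
elim: j => [|j IH]; first by rewrite addn0.
by rewrite addnS; apply: le_trans IH; exact: HiPPA_err_le.
Qed.

Lemma HiPPA_sum_sqr k : \sum_(i < k) s i ^+ 2 + e k ^+ 2 <= e 0 ^+ 2.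
Proof.
elim: k => [|k IH]; first by rewrite big_ord0 add0r.
apply: le_trans IH; rewrite big_ord_recr /= -addrA lerD2l.
rewrite [leRHS]HiPPA_pythagoras lerD2r lerDl mulrn_wge0 //.
exact: HiPPA_dotv_ge0.
Qed.

(* While the error stays above [eps], the modulus keeps the steps bounded
   below, which the square-summability of the steps allows only finitely often. *)
Lemma HiPPA_err_small eps : 0 < eps ->
  exists K, forall k, (K <= k)%N -> e k < eps.
Proof.
move=> eps0; have pB1 : 0 < p - 1 by rewrite subr_gt0.
have [phi_ge0 phi_homo phi_eq0] := phi_modulus.
(* A positive real minorant of [phi eps]: the value itself if finite, and 1 if it is +oo. *)
have [m m0 mphi] : exists2 m : R, 0 < m & (m%:E <= phi eps)%E.
  have := phi_ge0 _ (ltW eps0); case E : (phi eps) => [r| |] //.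
    rewrite lee_fin le_eqVlt => /orP[/eqP r0|r0]; last by exists r.
    by move: E; rewrite -r0 phi_eq0 ?ltW // => E; rewrite E ltxx in eps0.
  by exists 1; rewrite ?leey.
have e0 : 0 <= e 0 := enorm_ge0 _.
have g0 := HiPPA_gmin_gt0.
have e1 : 0 < e 0 + 1 by rewrite ltr_wpDl.
(* The lower bound on the steps, solved from gmin m <= s^(p-1) (e 0 + 1); adding 1 keeps the divisor
   positive. *)
pose delta := (gmin * m / (e 0 + 1)) `^ (1 / (p - 1)).
have d0 : 0 < delta by rewrite powR_gt0 // divr_gt0 // mulr_gt0.
(* Chosen so that K delta^2 exceeds e 0 ^ 2, the bound on the sum of the squared steps. *)
pose K := Num.bound (e 0 ^+ 2 / delta ^+ 2).
exists K => k Kk; rewrite ltNge; apply/negP => ek.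
have big_e j : (j <= K)%N -> eps <= e j.
  move=> jK; apply: le_trans ek _.
  by rewrite -(subnKC (leq_trans jK Kk)); exact: HiPPA_err_le_add.
have big_s (i : 'I_K) : delta ^+ 2 <= s i ^+ 2.
  rewrite ler_sqr ?nnegrE ?enorm_ge0 ?(ltW d0) //.
  have mi : (m%:E <= phi (e i.+1))%E.
    by apply: le_trans mphi _; apply: phi_homo; [exact: ltW | exact: big_e].
  have := HiPPA_modulus_le (ltW m0) mi.
  have ei : e i.+1 <= e 0 + 1.
    by rewrite ler_wpDr // (HiPPA_err_le_add 0 i.+1).
  have gi : gmin * m <= gamma i * m by rewrite ler_pM2r // ltW // HiPPA_gamma_gt.
  move=> /(le_trans gi) H.
  have {}H := le_trans H (ler_wpM2l (powR_ge0 _ _) ei).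
  rewrite -ler_pdivrMr // in H.
  have s0 : 0 <= s i := enorm_ge0 _.
  have -> : s i = (s i `^ (p - 1)) `^ (p - 1)^-1.
    by rewrite -powRrM divff ?gt_eqF // powRr1.
  rewrite /delta div1r.
  apply: ler_powR_base H; first by rewrite invr_ge0 ltW.
  by rewrite divr_ge0 ?mulr_ge0 // ltW.
have := HiPPA_sum_sqr K.
have : \sum_(i < K) delta ^+ 2 <= \sum_(i < K) s i ^+ 2.
  by apply: ler_sum => i _; exact: big_s.
rewrite sumr_const card_ord => H1 H2.
have : delta ^+ 2 *+ K <= e 0 ^+ 2.
  by apply: le_trans H1 (le_trans _ H2); rewrite lerDl sqr_ge0.
apply/negP; rewrite -ltNge -mulr_natl -ltr_pdivrMr ?exprn_gt0 //.
by apply: archi_boundP; rewrite divr_ge0 ?sqr_ge0.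
Qed.

Lemma HiPPA_cvg : x @ \oo --> xbar.
Proof.
apply/cvgrPdist_lt => eps /HiPPA_err_small[K HK].
exists K => // k /HK; apply: le_lt_trans.
by rewrite distrC normr_le_enorm.
Qed.

(** One factor |d| cancels in gamma phi |d| <= |a|^(p-1) |d|. Growth is assumed only at the value
    [e k.+1], so the lemma serves both the local hypothesis of (a) and the global one of (d). *)
Lemma HiPPA_power_le k q rho : 0 <= rho -> 1 < q ->
  ((rho * e k.+1 `^ q)%:E <= phi (e k.+1))%E ->
  gmin * rho * e k.+1 `^ (q - 1) <= e k `^ (p - 1).
Proof.
move=> rho0 q1 H; have q0 : 0 < q by exact: lt_trans q1.
have pB1 : 0 <= p - 1 by rewrite subr_ge0 ltW.
have D0 : 0 <= e k.+1 := enorm_ge0 _.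
have [->|Dn0] := eqVneq (e k.+1) 0.
  by rewrite powR0 ?subr_eq0 ?gt_eqF // mulr0 powR_ge0.
have D_gt0 : 0 < e k.+1 by rewrite lt_neqAle eq_sym Dn0.
apply: (@le_trans _ _ (gamma k * rho * e k.+1 `^ (q - 1))).
  by rewrite ler_wpM2r ?powR_ge0 // ler_wpM2r // ltW // HiPPA_gamma_gt.
apply: (@le_trans _ _ (s k `^ (p - 1))); last first.
  by apply: ler_powR_base => //; [exact: enorm_ge0 | exact: HiPPA_step_le].
rewrite -(ler_pM2r D_gt0).
have -> : gamma k * rho * e k.+1 `^ (q - 1) * e k.+1 =
    gamma k * (rho * e k.+1 `^ q) by rewrite -(mulr_powRB1 D0 q0); ring.
by apply: HiPPA_modulus_le => //; rewrite mulr_ge0 ?powR_ge0.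
Qed.

(** The additional 1 in the factor comes from the term - |d|^2 in the bound on <a, d>; p >= 2 makes
    the power p - 2 monotone. *)
Lemma HiPPA_power_le_same k rho : 2 <= p -> 0 < rho ->
  ((rho * e k.+1 `^ p)%:E <= phi (e k.+1))%E ->
  (gmin * rho + 1) * e k.+1 `^ (p - 1) <= e k `^ (p - 1).
Proof.
move=> p2 rho0 H.
have p0 := lt_trans ltr01 p_gt1.
have pB1 : 0 < p - 1 by rewrite subr_gt0.
have pB2 : 0 <= p - 2 by rewrite subr_ge0.
have D0 : 0 <= e k.+1 := enorm_ge0 _.
have s0 : 0 <= s k := enorm_ge0 _.
have e0 : 0 <= e k := enorm_ge0 _.
have [->|Dn0] := eqVneq (e k.+1) 0.
  by rewrite powR0 ?gt_eqF // mulr0 powR_ge0.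
have D_gt0 : 0 < e k.+1 by rewrite lt_neqAle eq_sym Dn0.
have m_gt0 : 0 < rho * e k.+1 `^ p by rewrite mulr_gt0 ?powR_gt0.
(* A zero step would force gamma m <= 0; positivity allows division by [s k] in [sw]. *)
have s_gt0 : 0 < s k.
  rewrite lt_neqAle eq_sym s0 andbT; apply: contraTneq (HiPPA_modulus_le (ltW m_gt0) H) => ->.
  by rewrite powR0 ?gt_eqF // mul0r -ltNge mulr_gt0 // HiPPA_gamma_gt0.
have powB1 y : 0 < y -> y `^ (p - 1) = y * y `^ (p - 2).
  by move=> y0; rewrite -(mulr_powRB1 (ltW y0) pB1) -addrA -opprD.
have e_gt0 : 0 < e k by apply: lt_le_trans D_gt0 (HiPPA_err_le k).
have sw : gamma k * (rho * e k.+1 `^ p) <= s k `^ (p - 2) * w k.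
  have := HiPPA_modulus_le_dotv (ltW m_gt0) H.
  by rewrite powB1 // mulrC -mulrA ler_pM2l.
(* Cauchy-Schwarz for <a + d, d> = <a, d> + |d|^2. *)
have CS : w k <= (e k - e k.+1) * e k.+1.
  have := dotv_le_enorm (x k - xbar) (x k.+1 - xbar).
  have -> : x k - xbar = (x k - x k.+1) + (x k.+1 - xbar) by rewrite addrA subrK.
  rewrite dotvDl -enorm_sqr addrA subrK -/(w k) -/(e k) -/(e k.+1) => K.
  by rewrite mulrBl lerBrDr -expr2.
have se : s k `^ (p - 2) <= e k `^ (p - 2) by apply: ler_powR_base (HiPPA_step_le k).
have De : e k.+1 `^ (p - 2) <= e k `^ (p - 2) by apply: ler_powR_base (HiPPA_err_le k).
have ge : gmin * (rho * e k.+1 `^ p) <= gamma k * (rho * e k.+1 `^ p).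
  by rewrite ler_pM2r // ltW // HiPPA_gamma_gt.
have {}sw := le_trans sw (ler_pM (powR_ge0 _ _) (HiPPA_dotv_ge0 k) se CS).
have {sw ge} := le_trans ge sw.
rewrite -(mulr_powRB1 D0 p0) [(_ + 1) * _]mulrDl mul1r.
set P := e k.+1 `^ (p - 1).
have -> : gmin * (rho * (e k.+1 * P)) = gmin * rho * P * e k.+1 by ring.
rewrite mulrA ler_pM2r // => K.
(* With E = [e k] and D = [e k.+1], the bound [K] ends in E^(p-1) - D E^(p-2), and D E^(p-2) >=
   D^(p-1). *)
rewrite -lerBrDr; apply: le_trans K _.
rewrite /P !powB1 // mulrC mulrBl lerD2l lerN2.
by rewrite ler_pM2l.
Qed.

End HiPPAIterates.

(** * The four convergence rates *)

Theorem theorem4p9 (R : realType) (n : nat)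
  (f : 'rV[R]_n -> \bar R) (phi : R -> \bar R) (C : set 'rV[R]_n)
  (p gmin gmax : R) (gamma : nat -> R) (x : nat -> 'rV[R]_n) (xbar : 'rV[R]_n)
  (f_proper : proper_fun f)
  (f_lsc : lower_semicontinuous f)
  (f_coercive : coercive f)
  (C_neq0 : C !=set0)
  (C_closed : closed C)
  (C_convex : convex_set C)
  (C_dom : C `<=` dom f)
  (phi_modulus : modulus phi)
  (f_uqc : uniformly_quasiconvex f phi C)
  (p_gt1 : 1 < p)
  (x_HiPPA : HiPPA C f p gmin gmax gamma x)
  (xbar_argmin : argmin C f = [set xbar]) :
  [/\ (* (a) *)
      (forall q rho : R, 1 < q < 2 -> 0 < rho ->
        (forall t, 0 <= t < 1 -> ((rho * t `^ q)%:E <= phi t)%E) ->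
        q <= p < 2 -> 1 / rho < gmin ->
        exists K : nat, forall k, (K <= k)%N ->
          (err_ratio x xbar k
             <= ((1 / (rho * gmin)) `^ (1 / (p - 1)))%:E < 1)%E),
      (* (b) *)
      (forall rho : R, p = 2 -> 0 < rho ->
        (forall t, 0 <= t -> ((rho * t ^+ 2)%:E <= phi t)%E) ->
        forall k, (err_ratio x xbar k <= (1 / (1 + gmin * rho))%:E < 1)%E),
      (* (c) *)
      (forall rho : R, 2 < p -> 0 < rho ->
        (forall t, 0 <= t -> ((rho * t `^ p)%:E <= phi t)%E) ->
        1 / rho < gmin ->
        forall k, (err_ratio x xbar k
          <= ((p / (p * gmin * rho + sigma_hat p)) `^ (1 / (p - 1)))%:E < 1)%E)
    & (* (d) *)
      (forall q rho : R, 2 <= q -> 0 < rho ->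
        (forall t, 0 <= t -> ((rho * t `^ q)%:E <= phi t)%E) ->
        q < p ->
        Qsuperlinear x xbar ((p - 1) / (q - 1)) /\
        forall k, enorm (x k.+1 - xbar)
          <= (gmin * rho) `^ (- (1 / (q - 1)))
             * enorm (x k - xbar) `^ ((p - 1) / (q - 1)))].
Proof.
have xb : argmin C f xbar by rewrite xbar_argmin.
have gmin0 := HiPPA_gmin_gt0 x_HiPPA.
have pB1 : 0 < p - 1 by rewrite subr_gt0.
have p0 := lt_trans ltr01 p_gt1.
have e0 k : 0 <= enorm (x k - xbar) := enorm_ge0 _.
have small := HiPPA_err_small f_proper C_convex C_dom phi_modulus f_uqc p_gt1 x_HiPPA xb.
have power_le := HiPPA_power_le f_proper C_convex C_dom phi_modulus f_uqc p_gt1 x_HiPPA xb.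
have power_le_same :=
  HiPPA_power_le_same f_proper C_convex C_dom phi_modulus f_uqc p_gt1 x_HiPPA xb.
split.
- move=> q rho /andP[q1 q2] rho0 phi_ge /andP[qp p2] rho_gmin.
  have rg0 : 0 < rho * gmin by rewrite mulr_gt0.
  (* From [K] on the errors are below 1, where the growth condition applies. *)
  have [K HK] := small 1 ltr01.
  exists K => k Kk; apply/andP; split; last first.
    rewrite lte_fin powR_lt1 ?divr_gt0 // divr_ge0 ?(ltW rg0) //=.
    by rewrite ltr_pdivrMr // mul1r mulrC -ltr_pdivrMr.
  apply: err_ratio_le; first exact: powR_ge0.
  have e1 : enorm (x k.+1 - xbar) < 1 by apply: HK; exact: leqW.
  apply: ler_powR_scale => //; rewrite [rho * _]mulrC.
  have phi_e : ((rho * enorm (x k.+1 - xbar) `^ q)%:E <=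
      phi (enorm (x k.+1 - xbar)))%E by apply: phi_ge; rewrite e0.
  apply: le_trans (power_le _ _ _ (ltW rho0) q1 phi_e).
  rewrite ler_pM2l ?mulr_gt0 //.
  have [->|en0] := eqVneq (enorm (x k.+1 - xbar)) 0.
    by rewrite powR0 ?powR_ge0 ?gt_eqF.
  (* The base is at most 1 and q <= p, so passing from exponent q - 1 to p - 1 decreases the
     power. *)
  apply: ger_powR; last by rewrite lerD2r.
  by rewrite lt_neqAle eq_sym en0 e0 ltW.
- move=> rho p2 rho0 phi_ge k.
  have gr0 : 0 < gmin * rho by rewrite mulr_gt0.
  have gr1 : 0 < 1 + gmin * rho by rewrite addr_gt0.
  apply/andP; split; last by rewrite lte_fin ltr_pdivrMr // mul1r ltrDl.
  apply: err_ratio_le; first by rewrite divr_ge0 ?(ltW gr1).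
  have phi_e : ((rho * enorm (x k.+1 - xbar) `^ p)%:E <=
      phi (enorm (x k.+1 - xbar)))%E by rewrite p2 powR_mulrn // phi_ge.
  have p2' : 2 <= p by rewrite p2.
  have := power_le_same _ _ p2' rho0 phi_e.
  have -> : p - 1 = 1 by rewrite p2; lra.
  by rewrite !powRr1 // (addrC _ 1) div1r (mulrC _^-1) ler_pdivlMr // (mulrC (enorm _)).
- move=> rho p2 rho0 phi_ge rho_gmin k.
  have gr1 : 1 < gmin * rho by rewrite -ltr_pdivrMr.
  have [sg0 sg1] := (sigma_hat_gt0 p, sigma_hat_lt1 p_gt1).
  set den := p * gmin * rho + sigma_hat p.
  have denp : p < den.
    rewrite /den -mulrA; apply: (@lt_trans _ _ (p * (gmin * rho))).
      by rewrite ltr_pMr.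
    by rewrite ltrDl.
  have den0 := lt_trans p0 denp.
  apply/andP; split; last first.
    rewrite lte_fin powR_lt1 ?divr_gt0 // divr_ge0 ?(ltW p0) ?(ltW den0) //=.
    by rewrite ltr_pdivrMr // mul1r.
  apply: err_ratio_le; first exact: powR_ge0.
  have -> : p / den = 1 / (den / p) by rewrite div1r invf_div.
  apply: ler_powR_scale; rewrite ?divr_gt0 //.
  (* Here den / p = gmin rho + sigma_hat p / p, which is at most gmin rho + 1. *)
  apply: le_trans (power_le_same k _ (ltW p2) rho0 (phi_ge _ (e0 _))).
  apply: ler_wpM2r; first exact: powR_ge0.
  rewrite ler_pdivrMr // /den mulrDl mul1r; apply: lerD.
    by rewrite -(mulrA p) (mulrC p).
  by rewrite ltW // (lt_trans sg1).
- move=> q rho q2 rho0 phi_ge qp.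
  have gr0 : 0 < gmin * rho by rewrite mulr_gt0.
  have q1 : 1 < q by lra.
  have qB1 : 0 < q - 1 by rewrite subr_gt0.
  (* The (q - 1)-th root of [power_le], with the constant moved into a negative exponent. *)
  have rate k : enorm (x k.+1 - xbar) <= (gmin * rho) `^ (- (1 / (q - 1))) *
      enorm (x k - xbar) `^ ((p - 1) / (q - 1)).
    have := power_le k q rho (ltW rho0) q1 (phi_ge _ (e0 _)).
    move=> /(ler_powR_root gr0 qB1 (e0 _)).
    rewrite powRM ?powR_ge0 ?invr_ge0 ?(ltW gr0) // -powRrM div1r mulrC.
    by rewrite -[- _^-1]mulN1r (powRrM _ (-1)) powR_inv1 ?(ltW gr0).
  split=> //; split.
  + exact: (HiPPA_cvg f_proper C_convex C_dom phi_modulus f_uqc p_gt1 x_HiPPA xb).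
  + by rewrite ltr_pdivlMr // mul1r ltrD2r.
  + by exists ((gmin * rho) `^ (- (1 / (q - 1)))) => //; rewrite powR_gt0.
Qed.
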